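(* Let $R$ be an associative ring with unity, let $n\ge 3$, and regard $\mathrm{Um}_n(R)$ as the unimodular row global action with base point $e=(1,0,\ldots,0)$. Then $$\pi_0(\mathrm{Um}_n(R))=\mathrm{Um}_n(R)/\mathrm{E}_n(R),$$ i.e. two rows $v,w\in \mathrm{Um}_n(R)$ are path connected in this global action if and only if $v\,\mathrm{E}_n(R)=w\,\mathrm{E}_n(R)$. Giving $\mathrm{Um}_n(R)/\mathrm{E}_n(R)$ the base point $e\,\mathrm{E}_n(R)$, the connected component of $e$ in $\mathrm{Um}_n(R)$ is $e\,\mathrm{E}_n(R)$.
   Context: $\mathrm{Um}_n(R)$ is the set of rows $v=(v_1,\ldots,v_n)\in R^n$ for which there is $w=(w_1,\ldots,w_n)\in R^n$ with $\sum_i v_iw_i=1$; $\mathrm{GL}_n(R)$ acts on it by right multiplication. For $i\neq j$ and $r\in R$, $E_{ij}(r)=I_n+re_{ij}$, where $e_{ij}$ is the matrix unit; $\mathrm{E}_n(R)$ is the subgroup of $\mathrm{GL}_n(R)$ generated by all $E_{ij}(r)$. Let $J_n=\{(i,j):1\le i,j\le n,\ i\ne j\}$. A subset $\alpha\subseteq J_n$ is nilpotent if $(i,j)\in\alpha$ implies $(j,i)\notin\alpha$, and $(i,j),(j,k)\in\alpha$ imply $(i,k)\in\alpha$. $\Phi_n$ is the set of nilpotent subsets, ordered by inclusion. For $\alpha\in\Phi_n$, $\mathrm{E}_n(R)_\alpha$ is the subgroup of matrices with $1$'s on the diagonal, arbitrary entries at positions in $\alpha$, and $0$ at all other off-diagonal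 positions. The unimodular row global action has underlying set $\mathrm{Um}_n(R)$, index set $\Phi_n$, and local groups $\mathrm{E}_n(R)_\alpha$ ($\alpha\in\Phi_n$), each acting on the whole of $\mathrm{Um}_n(R)$ by right multiplication. A path in it is a map $\omega:\mathbb Z\to \mathrm{Um}_n(R)$ such that for every $m\in\mathbb{Z}$ there is $\alpha\in\Phi_n$ with $\omega(m+1)\in\omega(m)\mathrm{E}_n(R)_\alpha$, and which is constant for all sufficiently negative $m$ (this constant value is its initial point) and constant for all sufficiently large $m$ (this value is its terminal point). Two points are path connected if there is a path with one as initial and the other as terminal point; this is an equivalence relation, and $\pi_0$ is the set of its equivalence classes (path connected components). *)

(* Defs.v *)
From HB Require Import structures.
From mathcomp Require Import all_boot all_order all_algebra.
From mathcomp Require Import boolp classical_sets.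

Set Implicit Arguments.
Unset Strict Implicit.
Unset Printing Implicit Defensive.

Import Order.TTheory GRing.Theory Num.Theory.

Local Open Scope classical_set_scope.
Local Open Scope ring_scope.

Section UnimodularRows.
(* [pzRingType]: associative unital rings, neither assumed commutative nor
   nontrivial. *)
Variables (R : pzRingType) (n : nat).
Implicit Types (v w : 'rV[R]_n) (g h : 'M[R]_n).

Definition Um : set 'rV[R]_n :=
  [set v | exists w : 'rV[R]_n, \sum_(i < n) v 0 i * w 0 i = 1].

(* MathComp's [unitmx] and ['GL_n[R]] require a commutative ring. *)
Definition GL : set 'M[R]_n :=
  [set g | exists h, g *m h = 1%:M /\ h *m g = 1%:M].

Record GL_subgroup (H : set 'M[R]_n) : Prop := GLSubgroup {
  GL_subgroup_sub : H `<=` GL;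
  GL_subgroup1 : H 1%:M;
  GL_subgroupM : forall g h, H g -> H h -> H (g *m h);
  GL_subgroupV : forall g h,
    H g -> g *m h = 1%:M -> h *m g = 1%:M -> H h
}.

Definition elemmx (i j : 'I_n) (r : R) : 'M[R]_n := 1%:M + r *: delta_mx i j.

Definition elemmxs : set 'M[R]_n :=
  [set g | exists i j r, i != j /\ g = elemmx i j r].

Definition En : set 'M[R]_n := smallest GL_subgroup elemmxs.

Definition Um_orbit v : set 'rV[R]_n := [set v *m g | g in En].

Definition Um_quotient : set (set 'rV[R]_n) := [set Um_orbit v | v in Um].

Definition Jn : {set 'I_n * 'I_n} := [set p | p.1 != p.2]%SET.

Definition Phi : set {set 'I_n * 'I_n} :=
  [set alpha | [/\ alpha \subset Jn,
     forall i j, (i, j) \in alpha -> (j, i) \notin alpha &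
     forall i j k,
       (i, j) \in alpha -> (j, k) \in alpha -> (i, k) \in alpha]].

Definition En_local (alpha : {set 'I_n * 'I_n}) : set 'M[R]_n :=
  [set g | (forall i, g i i = 1) /\
           (forall i j, i != j -> (i, j) \notin alpha -> g i j = 0)].

Definition Um_path (omega : int -> 'rV[R]_n) (v w : 'rV[R]_n) : Prop :=
  [/\ forall m, Um (omega m),
      forall m, exists2 alpha, Phi alpha &
        [set omega m *m g | g in En_local alpha] (omega (m + 1)),
      exists N : int, forall m, m <= N -> omega m = v &
      exists N : int, forall m, N <= m -> omega m = w].

Definition path_connected v w : Prop := exists omega, Um_path omega v w.

Definition path_component v : set 'rV[R]_n := [set w | path_connected v w].

Definition pi0 : set (set 'rV[R]_n) := [set path_component v | v in Um].

Definition base_row : 'rV[R]_n := \row_(j < n) (val j == 0%N)%:R.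

Lemma base_row_Um : (0 < n)%N -> Um base_row.
Proof.
move=> n0; exists base_row; rewrite (bigD1 (Ordinal n0)) //= !mxE /= mulr1.
rewrite big1 ?addr0 // => i ni; rewrite !mxE.
by rewrite -[0%N]/(val (Ordinal n0)) val_eqE (negbTE ni) mulr0.
Qed.

End UnimodularRows.

Arguments Um : clear implicits.
Arguments GL : clear implicits.
Arguments En : clear implicits.
Arguments elemmxs : clear implicits.
Arguments Um_quotient : clear implicits.
Arguments pi0 : clear implicits.
Arguments En_local : clear implicits.
Arguments base_row : clear implicits.

(* Main.v *)
Require Import Defs.
From HB Require Import structures.
From mathcomp Require Import all_boot all_order all_algebra.
From mathcomp Require Import boolp classical_sets.

(** A path moves, at each step, by a matrix of some local group [En_local alpha].
   Two facts identify its reach with the orbit of its initial point.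

   - Every local group lies in [En] ([En_local_sub_En]).  A nilpotent [alpha] is
     a strict partial order on the indices.  If [i] is minimal among the rows in
     which [g] may have a nonzero off-diagonal entry, then column [i] of [g] is
     the [i]-th unit column, so factoring an elementary matrix [elemmx i j (g i j)] out of [g]
     on the right removes the entry [(i, j)] and changes nothing else.  Removing
     the entries one by one writes [g] as a product of elementary matrices.
     Hence every value of a path lies in the orbit of its initial point
     ([path_connected_orbit]).

   - Every elementary matrix lies in a local group, that of the singleton
     [(i, j)].  So right multiplication by it is a path with a single step, and
     paths can be concatenated.  As the inverse of an elementary matrix is
     elementary, [En] is already generated by the elementary matrices as a
     monoid, so each [v *m g] with [g] in [En] is reached from [v]
     ([En_path_connected]).

   Therefore the path component of a unimodular row is its orbit
   ([path_componentE]), and the three claims follow since the orbits of the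
   group [En] partition the rows. *)

Set Implicit Arguments.
Unset Strict Implicit.
Unset Printing Implicit Defensive.

Import Order.TTheory GRing.Theory Num.Theory.

Local Open Scope classical_set_scope.
Local Open Scope ring_scope.

(** * The elementary group *)

Section ElementaryGroup.
Variables (R : pzRingType) (n : nat).
Implicit Types (v w : 'rV[R]_n) (g h : 'M[R]_n) (alpha beta : {set 'I_n * 'I_n}).

Lemma scale_delta_mx_mul0 (i j : 'I_n) (r s : R) :
  i != j -> (r *: delta_mx i j) *m (s *: delta_mx i j) = 0 :> 'M[R]_n.
Proof.
move=> ij; apply/matrixP => a b; rewrite !mxE big1 // => k _; rewrite !mxE.
have [->|_] := eqVneq k j; last by rewrite andbF mulr0 mul0r.
by rewrite (eq_sym j i) (negbTE ij) /= !mulr0.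
Qed.

Lemma elemmxK (i j : 'I_n) (r : R) :
  i != j -> elemmx i j r *m elemmx i j (- r) = 1%:M.
Proof.
move=> ij; rewrite /elemmx mulmxDl mul1mx mulmxDr mulmx1.
by rewrite scale_delta_mx_mul0 // addr0 -addrA scaleNr addNr addr0.
Qed.

Lemma elemmxNK (i j : 'I_n) (r : R) :
  i != j -> elemmx i j (- r) *m elemmx i j r = 1%:M.
Proof. by move=> ij; rewrite -{2}[r]opprK elemmxK. Qed.

Lemma inverse_uniq g h1 h2 : h1 *m g = 1%:M -> g *m h2 = 1%:M -> h1 = h2.
Proof. by move=> hg gh; rewrite -[h1]mulmx1 -gh mulmxA hg mul1mx. Qed.

Lemma elemmxs_GL : elemmxs R n `<=` GL R n.
Proof.
move=> _ [i [j [r [ij ->]]]]; exists (elemmx i j (- r)).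
by rewrite elemmxK // elemmxNK.
Qed.

Lemma GL_mul g h : GL R n g -> GL R n h -> GL R n (g *m h).
Proof.
move=> [g' [gg' g'g]] [h' [hh' h'h]]; exists (h' *m g'); split.
  by rewrite mulmxA -(mulmxA g) hh' mulmx1.
by rewrite mulmxA -(mulmxA h') g'g mulmx1.
Qed.

Lemma GL_subgroup_GL : GL_subgroup (GL R n).
Proof.
split=> //.
- by exists 1%:M; rewrite mulmx1.
- exact: GL_mul.
- by move=> g h _ gh hg; exists g.
Qed.

Lemma GL_subgroup_En : GL_subgroup (En R n).
Proof.
split.
- by move=> g; apply; split; [exact: GL_subgroup_GL|exact: elemmxs_GL].
- by move=> H [HG _]; exact: GL_subgroup1 HG.
- move=> g h Eg Eh H [HG sH].
  by apply: (GL_subgroupM HG); [exact: Eg|exact: Eh].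
- by move=> g h Eg gh hg H [HG sH]; apply: (GL_subgroupV HG _ gh hg); exact: Eg.
Qed.

Lemma elemmx_En (i j : 'I_n) (r : R) : i != j -> En R n (elemmx i j r).
Proof. by move=> ij H [_]; apply; exists i, j, r. Qed.

(** [En] is generated by the elementary matrices as a monoid: those [g] in [GL]
   such that both [g] and its inverse lie in [M] form a group, and this group
   contains the elementary matrices because their inverses are elementary. *)
Lemma En_sub_monoid (M : set 'M[R]_n) :
    M 1%:M -> (forall g h, M g -> M h -> M (g *m h)) -> elemmxs R n `<=` M ->
  En R n `<=` M.
Proof.
move=> M1 MM sM g Eg.
pose H := [set g | M g /\
  exists h, [/\ M h, g *m h = 1%:M & h *m g = 1%:M]].
suff: H g by case.
apply: Eg; split; first split.
- by move=> a [_ [b [_ ab ba]]]; exists b.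
- by split=> //; exists 1%:M; rewrite mulmx1.
- move=> a b [Ma [a' [Ma' aa' a'a]]] [Mb [b' [Mb' bb' b'b]]].
  split; first exact: MM.
  exists (b' *m a'); split; first exact: MM.
    by rewrite mulmxA -(mulmxA a) bb' mulmx1.
  by rewrite mulmxA -(mulmxA b') a'a mulmx1.
- move=> a b [Ma [a' [Ma' aa' a'a]]] ab ba.
  have -> : b = a' by exact: inverse_uniq ba aa'.
  by split=> //; exists a.
- move=> _ [i [j [r [ij ->]]]]; split; first by apply: sM; exists i, j, r.
  exists (elemmx i j (- r)); rewrite elemmxK // elemmxNK //; split=> //.
  by apply: sM; exists i, j, (- r).
Qed.

Lemma Um_mulmx v g : Um R n v -> GL R n g -> Um R n (v *m g).
Proof.
have UmE (u w : 'rV[R]_n) : \sum_(i < n) u 0 i * w 0 i = (u *m w^T : 'M[R]_1) 0 0.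
  by rewrite !mxE; apply: eq_bigr => i _; rewrite !mxE.
move=> [w vw] [h [gh _]]; exists (h *m w^T)^T.
by rewrite UmE trmxK mulmxA -(mulmxA v) gh mulmx1 -UmE.
Qed.

(** * The local groups *)

(** [beta] orders the indices strictly, and the number of predecessors is
   strictly increasing for this order. *)
Lemma card_predecessors_lt beta (i k : 'I_n) : Phi beta -> (k, i) \in beta ->
  (#|[set l | (l, k) \in beta]%SET| < #|[set l | (l, i) \in beta]%SET|)%N.
Proof.
move=> [sJ asym trans] ki; apply/proper_card/properP; split.
  by apply/fintype.subsetP => l; rewrite !inE => /trans; apply.
exists k; rewrite inE //; apply/negP => kk.
by have := asym _ _ kk; rewrite kk.
Qed.

(** Removing a position can destroy the transitivity of [alpha], but not its
   inclusion in the fixed nilpotent [beta]; this is what the induction on the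
   number of positions in [alpha] keeps. *)
Lemma En_local_sub_En_of_subset beta alpha : Phi beta -> alpha \subset beta ->
  En_local R n alpha `<=` En R n.
Proof.
move=> Pb; have [m] := ubnP #|alpha|; elim: m alpha => // m IH alpha.
rewrite ltnS => le_m sab g [g1 g0].
have [alpha0|/set0Pn [p0 p0a]] := eqVneq alpha finset.set0.
  suff -> : g = 1%:M by exact: GL_subgroup1 GL_subgroup_En.
  apply/matrixP => a b; rewrite mxE.
  by have [->|ab] := eqVneq a b; rewrite ?g1 // g0 // alpha0 inE.
pose npred (p : 'I_n * 'I_n) := #|[set l | (l, p.1) \in beta]%SET|.
have [[i j] ija minij] := @arg_minnP _ p0 (fun p => p \in alpha) npred p0a.
have ij : i != j.
  by case: Pb => /fintype.subsetP sJ _ _; have := sJ _ (fintype.subsetP sab _ ija); rewrite inE.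
have noki k : (k, i) \notin alpha.
  apply/negP => kia; have := minij _ kia; rewrite leqNgt /npred /=.
  by rewrite card_predecessors_lt // (fintype.subsetP sab).
have coli k : g k i = (k == i)%:R.
  by have [->|ki] := eqVneq k i; rewrite ?g1 // g0.
pose r := g i j; pose g' := g - r *: delta_mx i j.
have g'E k l : g' k l = g k l - r *+ ((k == i) && (l == j)).
  by rewrite !mxE mulr_natr.
have -> : g = g' *m elemmx i j r.
  rewrite mulmxDr mulmx1 /g' mulmxBl.
  have -> : g *m (r *: delta_mx i j) = r *: delta_mx i j.
    apply/matrixP => k l; rewrite !mxE (bigD1 i) //= big1 ?addr0.
      by rewrite !mxE coli eqxx /= !mulr_natr mulr_natl -!mulrnA mulnC mulnb.
    by move=> a ai; rewrite !mxE (negbTE ai) /= !mulr0.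
  by rewrite scale_delta_mx_mul0 // subr0 subrK.
apply: (GL_subgroupM GL_subgroup_En); last exact: elemmx_En.
apply: (IH (alpha :\ (i, j))%SET).
- by move: le_m; rewrite (cardsD1 (i, j)) ija.
- exact: fintype.subset_trans (subsetDl _ _) sab.
split=> [k|k l kl].
  rewrite g'E g1; case: eqP => [->|_] /=; last by rewrite mulr0n subr0.
  by rewrite (negbTE ij) subr0.
rewrite !inE xpair_eqE negb_and negbK g'E => /orP [/andP [/eqP -> /eqP ->]|kla].
  by rewrite !eqxx subrr.
rewrite g0 //; case: andP => [[/eqP ki /eqP lj]|_]; last by rewrite subr0.
by move: kla; rewrite ki lj ija.
Qed.

Lemma En_local_sub_En alpha : Phi alpha -> En_local R n alpha `<=` En R n.
Proof. by move=> Pa; exact: En_local_sub_En_of_subset Pa (subxx _). Qed.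

Lemma En_local1 alpha : En_local R n alpha 1%:M.
Proof.
by split=> [i|i j ij _]; rewrite mxE ?eqxx // (negbTE ij).
Qed.

Lemma Phi_set1 (i j : 'I_n) : i != j -> Phi [set (i, j)]%SET.
Proof.
move=> ij; split.
- by apply/fintype.subsetP => p; rewrite !inE => /eqP ->.
- move=> a b; rewrite !inE !xpair_eqE => /andP [/eqP -> /eqP ->].
  by rewrite (negbTE ij) andbF.
- move=> a b c; rewrite !inE !xpair_eqE.
  by move=> /andP [_ /eqP ->]; rewrite (eq_sym j i) (negbTE ij).
Qed.

Lemma elemmx_En_local (i j : 'I_n) (r : R) :
  i != j -> En_local R n [set (i, j)]%SET (elemmx i j r).
Proof.
move=> ij; split=> [k|k l kl].
  rewrite !mxE eqxx; case: eqP => [->|_] /=; last by rewrite mulr0 addr0.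
  by rewrite (negbTE ij) mulr0 addr0.
by rewrite inE xpair_eqE !mxE (negbTE kl) => /negbTE ->; rewrite mulr0 addr0.
Qed.

(** * Paths *)

Lemma path_connected_step v w alpha : Um R n v -> Um R n w -> Phi alpha ->
  [set v *m g | g in En_local R n alpha] w -> path_connected v w.
Proof.
move=> Uv Uw Pa vw; exists (fun m : int => if m <= 0 then v else w); split.
- by move=> m; case: ifP.
- move=> m; exists alpha => //.
  have [m0|m0] := leP m 0; have [m1|m1] := leP (m + 1) 0 => //.
  + by exists 1%:M; [exact: En_local1|rewrite mulmx1].
  + by move: m1; rewrite lezD1 => /(lt_trans m0); rewrite ltxx.
  + by exists 1%:M; [exact: En_local1|rewrite mulmx1].
- by exists 0 => m ->.
- by exists 1 => m m1; rewrite leNgt (lt_le_trans ltr01 m1).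
Qed.

Lemma path_connected_refl v : Um R n v -> path_connected v v.
Proof.
move=> Uv; apply: (@path_connected_step v v finset.set0) => //.
  by split=> [|i j|i j k]; rewrite ?inE // finset.sub0set.
by exists 1%:M; [exact: En_local1|rewrite mulmx1].
Qed.

(** The second path is shifted so that it starts where the first one has become
   constant. *)
Lemma path_connected_trans u v w :
  path_connected u v -> path_connected v w -> path_connected u w.
Proof.
move=> [f [Uf Sf [A fA] [B fB]]] [h [Uh Sh [C hC] [D hD]]].
exists (fun m => if m <= B then f m else h (m - B + C)); split.
- by move=> m; case: ifP.
- move=> m; have [mB|mB] := leP m B; have [m1B|m1B] := leP (m + 1) B.
  + exact: Sf.
  + (* a step across the junction, where both paths take the value [v] *)
    have -> : m = B by apply/eqP; rewrite eq_le mB /=; move: m1B; rewrite ltzD1.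
    by rewrite fB // -(hC C) // [B + 1]addrC addrK [1 + C]addrC; exact: Sh.
  + by move: m1B; rewrite lezD1 => /(lt_trans mB); rewrite ltxx.
  + by rewrite (addrAC m 1) (addrAC _ 1 C); exact: Sh.
- exists (Num.min A B) => m; rewrite le_min => /andP [mA mB].
  by rewrite mB fA.
- exists (Num.max (B + 1) (D + B - C)) => m; rewrite ge_max => /andP [m1 m2].
  rewrite leNgt -lezD1 m1 /= hD //.
  by rewrite -lerBlDr lerBrDr addrAC.
Qed.

Lemma En_path_connected v g : Um R n v -> En R n g -> path_connected v (v *m g).
Proof.
move=> Uv Eg.
pose M := [set g | GL R n g /\ forall v, Um R n v -> path_connected v (v *m g)].
suff [_] : M g by apply.
apply: (@En_sub_monoid M) Eg.
- split; first exact: GL_subgroup1 GL_subgroup_GL.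
  by move=> u Uu; rewrite mulmx1; exact: path_connected_refl.
- move=> a b [Ga Pa] [Gb Pb]; split; first exact: GL_mul.
  move=> u Uu; rewrite mulmxA; apply: path_connected_trans (Pa _ Uu) _.
  by apply: Pb; exact: Um_mulmx.
- move=> a ea; have Ga := elemmxs_GL ea; split=> // u Uu.
  have Uua := Um_mulmx Uu Ga.
  have [i [j [r [ij aE]]]] := ea; apply: path_connected_step Uu Uua (Phi_set1 ij) _.
  by exists a => //; rewrite aE; exact: elemmx_En_local.
Qed.

Lemma path_connected_orbit v w : path_connected v w -> Um_orbit v w.
Proof.
move=> [f [_ Sf [A fA] [B fB]]].
have orb (k : nat) : Um_orbit v (f (A + k%:Z)).
  elim: k => [|k [g Eg gE]].
    exists 1%:M; first exact: GL_subgroup1 GL_subgroup_En.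
    by rewrite addr0 fA ?mulmx1.
  have [alpha Pa [a La aE]] := Sf (A + k%:Z).
  exists (g *m a).
    by apply: (GL_subgroupM GL_subgroup_En) => //; exact: En_local_sub_En La.
  by rewrite mulmxA gE aE -[k.+1]addn1 PoszD addrA.
have := orb `|B - A|%N; rewrite fB //.
by rewrite -lerBlDl abszE ler_norm.
Qed.

Lemma path_componentE v : Um R n v -> path_component v = Um_orbit v.
Proof.
move=> Uv; apply/seteqP; split=> w; first exact: path_connected_orbit.
by move=> [g Eg <-]; exact: En_path_connected.
Qed.

Lemma Um_orbit_eq v w : Um_orbit v w <-> Um_orbit v = Um_orbit w.
Proof.
have En1 := GL_subgroup1 GL_subgroup_En; have EnM := GL_subgroupM GL_subgroup_En.
split=> [[g Eg <-]|->]; last by exists 1%:M => //; rewrite mulmx1.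
have [h [gh hg]] := GL_subgroup_sub GL_subgroup_En Eg.
have Eh := GL_subgroupV GL_subgroup_En Eg gh hg.
apply/seteqP; split=> _ [a Ea <-].
  exists (h *m a); first exact: EnM.
  by rewrite mulmxA -(mulmxA v) gh mulmx1.
by exists (g *m a); [exact: EnM|rewrite mulmxA].
Qed.

End ElementaryGroup.

(** * Path components are orbits *)

Theorem proposition3p16 (R : pzRingType) (n : nat) (n_ge3 : (3 <= n)%N) :
  [/\ pi0 R n = Um_quotient R n,
      forall v w : 'rV[R]_n, Um R n v -> Um R n w ->
        (path_connected v w <-> Um_orbit v = Um_orbit w) &
      path_component (base_row R n) = Um_orbit (base_row R n)].
Proof.
split.
- by apply/seteqP; split=> _ [v Uv <-]; exists v; rewrite ?path_componentE.
- move=> v w Uv _; rewrite -Um_orbit_eq -path_componentE //.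
- by apply: path_componentE; apply: base_row_Um; exact: leq_trans n_ge3.
Qed.
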